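(* For any finite (rooted) tree $T$, there exists a Cantor set $C\subset \mathbb{R}^2$ such that $\dim_{\rm H}(C)=1$ and the pinned tree distance set $\Delta^T_{y} (C)$ has nonempty interior in $\mathbb{R}^{m-1}$ for some $y\in C$, where $m$ is the number of vertices of $T$.
   Context: A Cantor set is a subset of $\mathbb{R}^d$ that is compact, totally disconnected, and perfect. $\dim_{\rm H}$ is Hausdorff dimension and $|\cdot|$ is the Euclidean norm. A tree is a connected acyclic graph; a finite tree is a tree whose vertex set is finite. Each tree $T$ carries a designated root, labeled $0$; write $\tau\in T$ for a vertex of $T$ and $\tau\sim\sigma$ when $\tau,\sigma$ are joined by an edge. If $T$ has $m$ vertices (hence $m-1$ edges), then for $X\subset\mathbb{R}^2$ and a pin $y\in X$, the pinned tree distance set is $$\Delta^T_y (X) = \{ (|y^\tau-y^\sigma|)_{\tau\sim \sigma}: \{y^\tau\}_{\tau \in T} \text{ is a set of distinct points in } X,\ y^0=y\}\subset\mathbb{R}^{m-1},$$ with one coordinate for each edge of $T$, the edges being listed in a fixed order (whether the interior is nonempty does not depend on the order). *)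

(* Defs.v *)
From HB Require Import structures.
From mathcomp Require Import all_boot all_order all_algebra.
From mathcomp Require Import all_classical all_reals all_analysis.
Import Order.TTheory GRing.Theory Num.Theory.
Import numFieldNormedType.Exports.

Set Implicit Arguments.
Unset Strict Implicit.
Unset Printing Implicit Defensive.


(* [ucycle e [:: x; y]] holds as soon as [e x y] and [e y x], so the cycles in
   the graph-theoretic sense are the [ucycle]s of size at least 3. *)
Record rtree := RTree {
  vertex :> finType;
  adj : rel vertex;
  root0 : vertex;
  adj_sym : symmetric adj;
  adj_irr : irreflexive adj;
  adj_connected : forall x y : vertex, connect adj x y;
  adj_acyclic : forall s : seq vertex, ucycle adj s -> (size s <= 2)%N
}.

(* Each edge {x, y} occurs exactly once, oriented by the enumeration order of
   the vertices. *)
Definition edges (T : rtree) : {set T * T} :=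
  [set p | adj p.1 p.2 && (enum_rank p.1 < enum_rank p.2)%N].

Section card_edges.
Variable T : rtree.
Local Notation r := (root0 T).

Let reach (n : nat) (x : T) : bool :=
  [exists t : n.-tuple T, path (@adj T) r t && (last r t == x)].

Let reach_ex (x : T) : exists n, reach n x.
Proof.
have /connectP[p pp ->] := adj_connected r x.
by exists (size p); apply/existsP; exists (in_tuple p); rewrite /= pp eqxx.
Qed.

Let dist (x : T) : nat := ex_minn (reach_ex x).

Let closer (x : T) : x != r -> exists y, adj x y && (dist y < dist x)%N.
Proof.
move=> xr; rewrite {2}/dist; case: ex_minnP => n /existsP[[t /= /eqP tn]].
case/lastP: t tn => [|t z] tn; first by rewrite eq_sym (negbTE xr) andbF.
rewrite rcons_path last_rcons => /andP[/andP[pt az] /eqP zx] _; subst z.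
exists (last r t); rewrite adj_sym az /= -tn size_rcons ltnS /dist.
case: ex_minnP => k _; apply; apply/existsP.
by exists (in_tuple t); rewrite /= pt eqxx.
Qed.

Let parent (x : T) : T :=
  if [pick y | adj x y && (dist y < dist x)%N] is Some y then y else r.

Let parentP (x : T) :
  x != r -> adj x (parent x) && (dist (parent x) < dist x)%N.
Proof.
by rewrite /parent => /closer[y Py]; case: pickP => // /(_ y); rewrite Py.
Qed.

Let dist_root : dist r = 0%N.
Proof.
rewrite /dist; case: ex_minnP => n _ h; apply/eqP; rewrite -leqn0; apply: h.
by apply/existsP; exists [tuple]; rewrite /= eqxx.
Qed.

Let parent_root : parent r = r.
Proof. by rewrite /parent; case: pickP => // y; rewrite dist_root ltn0 andbF. Qed.

Let iter_root (x : T) : exists k, iter k parent x = r.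
Proof.
have [n] := ubnP (dist x); elim: n x => // n IH x xn.
have [->|/parentP/andP[_ lt]] := eqVneq x r; first by exists 0%N.
have [k hk] := IH _ (leq_trans lt xn).
by exists k.+1; rewrite iterSr.
Qed.

Let adj_parent (u v : T) : adj u v -> (v == parent u) || (u == parent v).
Proof.
move=> auv.
have exP : exists n, [exists k : 'I_n.+1,
    iter k parent u == iter (n - k) parent v].
  have [a ha] := iter_root u; have [b hb] := iter_root v.
  have lt : (a < (a + b).+1)%N by rewrite ltnS leq_addr.
  exists (a + b)%N; apply/existsP; exists (Ordinal lt) => /=.
  by rewrite addKn ha hb.
case: (ex_minnP exP) => n /existsP[[j /= jn] /eqP ji] minn.
set i := (n - j)%N in ji.
have nij : n = (j + i)%N by rewrite /i subnKC.
have min (a b : nat) : iter a parent u = iter b parent v -> (j + i <= a + b)%N.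
  move=> ab; rewrite -nij; apply: minn; apply/existsP.
  have lt : (a < (a + b).+1)%N by rewrite ltnS leq_addr.
  by exists (Ordinal lt) => /=; rewrite addKn ab.
pose inj_upto (w : T) m := forall a b, (a < b)%N -> (b <= m)%N ->
  iter a parent w <> iter b parent w.
have inj_min (w : T) (m : nat) :
    (forall a, iter a parent w = iter m parent w -> (m <= a)%N) -> inj_upto w m.
  move=> minw a b ab bm eab.
  have : (m <= m - b + a)%N by apply: minw; rewrite iterD eab -iterD subnK.
  by rewrite leqNgt -{2}(subnK bm) ltn_add2l ab.
have inju : inj_upto u j.
  by apply: inj_min => a ea; have := min a i; rewrite leq_add2r ea; apply.
have injv : inj_upto v i.
  by apply: inj_min => a ea; have := min j a; rewrite leq_add2l ea; apply.
have step (w : T) (m k : nat) : inj_upto w m -> (k < m)%N ->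
    adj (iter k parent w) (iter k.+1 parent w).
  move=> h km; suff /parentP/andP[] : iter k parent w != r by [].
  apply/eqP => kr; apply: (h k k.+1 (ltnSn k) km).
  by rewrite /= kr parent_root.
have pathw (w : T) (m : nat) : inj_upto w m ->
    path (@adj T) w (traject parent (parent w) m).
  move=> h; apply/(pathP w) => k; rewrite size_traject => km.
  have km' : (k < m.+1)%N by exact: leqW.
  rewrite -trajectS nth_traject// (set_nth_default (parent w)) ?size_traject//.
  rewrite (nth_traject parent km) -iterSr.
  exact: step h km.
have uniqw (w : T) (m : nat) : inj_upto w m -> uniq (traject parent w m.+1).
  move=> h; apply/(uniqP w) => a b; rewrite !inE size_traject => am bm.
  rewrite !nth_traject// => eab; case: (ltngtP a b) => // lt.
    by case: (h a b lt bm).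
  by case: (h b a lt am).
pose q := traject parent (parent v) i.
have trq : traject parent v i = belast v q.
  have := lastI v q; have -> : v :: q = traject parent v i.+1 by [].
  by rewrite trajectSr => /rcons_inj[].
pose s := u :: traject parent (parent u) j ++ rev (belast v q).
have us : ucycle (@adj T) s.
  apply/andP; split.
    rewrite /s /= rcons_cat cat_path pathw//= -rev_cons last_traject ji.
    have -> : iter i parent v = last u (v :: q) by rewrite /= last_traject.
    have -> : u :: belast v q = belast u (v :: q) by [].
    rewrite rev_path (eq_path (e' := @adj T)) => [|x y]; last exact: adj_sym.
    by rewrite /= auv pathw.
  rewrite /s -cat_cons -trq -trajectS cat_uniq uniqw// rev_uniq andTb.
  apply/andP; split.
    apply/hasPn => x; rewrite mem_rev => /trajectP[k ki xk].
    apply/negP => /trajectP[l lj xl].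
    have := min l k; rewrite -xk -xl => /(_ erefl); rewrite leqNgt => /negP; apply.
    by rewrite -addnS leq_add// -ltnS.
  by have := uniqw _ _ injv; rewrite trajectSr rcons_uniq => /andP[].
have := adj_acyclic us.
rewrite /s /= size_cat size_rev size_belast !size_traject ltnS.
case: (j) (i) ji => [|[|j']] [|[|i']] //=.
- by move=> uv; move: auv; rewrite uv adj_irr.
- by move=> -> _; rewrite eqxx orbT.
- by move=> <- _; rewrite eqxx.
Qed.

Lemma card_edges : #|edges T| = #|T|.-1.
Proof.
pose f (x : T) : T * T :=
  if (enum_rank x < enum_rank (parent x))%N then (x, parent x)
  else (parent x, x).
have -> : edges T = f @: [set~ r].
  apply/setP => -[x y]; rewrite inE /=; apply/idP/imsetP => [|[z]].
    move=> /andP[axy xy]; have nr z : adj z (parent z) -> z \in [set~ r].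
      rewrite !inE => az; apply/negP => /eqP zr; move: az.
      by rewrite zr parent_root adj_irr.
    have /orP[/eqP yx|/eqP yx] := adj_parent axy.
      by exists x; [rewrite nr// -yx|rewrite /f -yx xy].
    exists y; first by rewrite nr// -yx adj_sym.
    by rewrite /f -yx ltnNge ltnW.
  rewrite !inE => /parentP/andP[az _]; rewrite /f.
  case: ltngtP => [lt|lt|/val_inj/enum_rank_inj e] [-> ->].
  - by rewrite az lt.
  - by rewrite adj_sym az lt.
  - by rewrite -e adj_irr in az.
rewrite card_in_imset ?cardsC1// => x y.
rewrite !inE => /parentP/andP[_ xr] /parentP/andP[_ yr].
have swap : x = parent y -> parent x = y -> x = y.
  move=> xy yx; move: xr yr; rewrite yx -xy => lt1 lt2.
  by have := ltn_trans lt1 lt2; rewrite ltnn.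
by rewrite /f; do 2 case: ifP => _; case=> // ? ?; apply: swap.
Qed.
End card_edges.

Local Open Scope classical_set_scope.
Local Open Scope ring_scope.

Section hausdorff.
Variables (R : realType) (n : nat).
Implicit Types (x : 'rV[R]_n) (A U : set 'rV[R]_n).

(* The library norm on ['rV[R]_n] is the maximum norm; it induces the same
   topology. *)
Definition eucl x : R := Num.sqrt (\sum_i x ord0 i ^+ 2).

Definition diam U : \bar R :=
  ereal_sup [set (eucl (p.1 - p.2))%:E | p in U `*` U].

(* [diam U `^ s], with the value 0 on the empty set (also when [s = 0]);
   [diam set0] is [-oo]. *)
Definition diam_pow (s : R) U : \bar R :=
  if U == set0 then 0%E else (diam U `^ s)%E.

Definition hausdorff_content_at (s delta : R) A : \bar R :=
  ereal_inf [set (\sum_(k <oo) diam_pow s (U k))%E |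
    U in [set U : nat -> set 'rV[R]_n |
      A `<=` \bigcup_k U k /\ forall k, (diam (U k) <= delta%:E)%E]].

Definition hausdorff_measure (s : R) A : \bar R :=
  ereal_sup [set hausdorff_content_at s delta A | delta in [set d : R | 0 < d]].

Definition hausdorff_dim A : \bar R :=
  ereal_inf [set s%:E | s in [set s : R | 0 <= s /\ hausdorff_measure s A = 0%E]].

Definition cantor_set A : Prop :=
  [/\ compact A, totally_disconnected A & perfect_set A].
End hausdorff.

Definition edge (T : rtree) (j : 'I_(#|T|.-1)) : T * T :=
  enum_val (cast_ord (esym (card_edges T)) j).

Definition pinned_tree_dist (R : realType) (T : rtree) (y : 'rV[R]_2)
    (X : set 'rV[R]_2) : set 'rV[R]_(#|T|.-1) :=
  [set \row_j eucl (f (edge j).1 - f (edge j).2) |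
    f in [set f : T -> 'rV[R]_2 |
      [/\ injective f, forall t, X (f t) & f (root0 T) = y]]].
Arguments pinned_tree_dist {R} T y X.

(* Main.v *)
Require Import Defs.
From HB Require Import structures.
From mathcomp Require Import all_boot all_order all_algebra.
From mathcomp Require Import all_classical all_reals all_analysis.
From mathcomp Require Import lra ring.
Import Order.TTheory GRing.Theory Num.Theory.
Import numFieldNormedType.Exports.
Local Open Scope classical_set_scope.
Local Open Scope ring_scope.

(** Read a sequence of binary digits [b] in base 2 and in base 4, as
    [u = \sum_k b_k / 2^(k+1)] and [y = \sum_k b_k / 4^(k+1)], and plot the
    point [(u - y, y)].  The points so obtained form a compact set on which
    [y] determines [b], so it is a copy of the Cantor space; the [2 ^ n]
    prefixes of length [n] cut it into parts of diameter at most [4 / 2 ^ n],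
    so its Hausdorff dimension is at most 1.

    Although it is totally disconnected, the set cannot be slipped
    through: it meets every nearly vertical curve [x = G y] with [G] of
    Lipschitz constant [1/2] and [0 <= G 0 <= 1/2] ([curve_meets_cantor]).
    The reason is that switching the digit [k] on moves a point to the
    right by [1 / 2^(k+1) - 1 / 4^(k+1)] and up by only [1 / 4^(k+1)], so
    the curve does not drift far while a greedy choice of digits closes in
    on it, and subtracting the base 4 expansion from the abscissa makes
    the two halves of each part overlap by exactly as much as the curve
    may drift. Vertical lines are such curves, so the shadow of the set on
    the horizontal axis contains an interval of length [1/2] and the
    dimension is at least 1 ([hausdorff_dim_ge1]).

    The Cantor set of the theorem is a disjoint union of translates of
    this set, one for each vertex, placed along the horizontal axis so
    that every parent is to the left of its children. Seen from a point of
    the parent's piece, the arc of a circle that crosses the child's piece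
    is a nearly vertical curve, so it meets that piece as soon as its
    radius lies in a certain interval ([circle_meets_piece]). That
    interval depends on the centre, which itself varies with the radii
    chosen earlier. But if all centres have offset at most [eta] from the
    corner of their piece, then all radii in an interval of length [eta]
    are good and the new point has offset at most [3 * eta]. So with
    tolerances that grow by a factor of at least 6 from parent to child,
    starting from the corner of the root piece as the pin, the points can
    be placed one vertex after another ([greedy_embedding]), and the
    distances along the edges fill a whole box. Points of different
    vertices are distinct because the pieces are disjoint. *)


(** * Binary digits read in base 2 and in base 4 *)

Section digits.
Context {R : realType}.
Implicit Types (q c : R) (b : nat -> bool).

Definition digit_sum q b (n : nat) : R := \sum_(k < n) (b k)%:R * q ^+ k.+1.

Definition digit_series q b : R := limn (digit_sum q b).

Lemma half_bounds : 0 <= (2^-1 : R) <= 2^-1.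
Proof. by apply/andP; split; lra. Qed.

Lemma quarter_bounds : 0 <= (4^-1 : R) <= 2^-1.
Proof. by apply/andP; split; lra. Qed.

Lemma digit_sumS q b n :
  digit_sum q b n.+1 = digit_sum q b n + (b n)%:R * q ^+ n.+1.
Proof. by rewrite /digit_sum big_ord_recr. Qed.

Lemma eq_digit_sum q b b' n : (forall k, (k < n)%N -> b k = b' k) ->
  digit_sum q b n = digit_sum q b' n.
Proof. by move=> e; apply: eq_bigr => k _; rewrite e. Qed.

Lemma digit_sum_ndecr q b : 0 <= q -> nondecreasing_seq (digit_sum q b).
Proof.
move=> q0; apply/nondecreasing_seqP => n.
by rewrite digit_sumS lerDl mulr_ge0// exprn_ge0.
Qed.

(** The condition [q * (1 + c) <= c] says that [c] bounds the geometric series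
    [q + q^2 + ...]; it makes [digit_sum q b n + c * q ^+ n] nonincreasing in
    [n]. *)
Lemma digit_sum_tail q c b (m n : nat) : 0 <= q -> 0 <= c -> q * (1 + c) <= c ->
  (m <= n)%N -> digit_sum q b n <= digit_sum q b m + c * q ^+ m.
Proof.
move=> q0 c0 qc /subnKC <-; move: (n - m)%N => {}n.
suff: digit_sum q b (m + n) + c * q ^+ (m + n) <= digit_sum q b m + c * q ^+ m.
  by apply: le_trans; rewrite lerDl mulr_ge0// exprn_ge0.
elim: n => [|n]; first by rewrite addn0.
apply: le_trans; rewrite addnS digit_sumS -addrA lerD2l exprS.
have qn : 0 <= q ^+ (m + n) by rewrite exprn_ge0.
by case: (b _) => /=; nra.
Qed.

Lemma is_cvg_digit_sum q b : 0 <= q <= 2^-1 -> cvgn (digit_sum q b).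
Proof.
move=> /andP[q0 q2]; apply: nondecreasing_is_cvgn (digit_sum_ndecr _ _ q0) _.
exists 1 => _ [n _ <-]; have := @digit_sum_tail q 1 b 0 n q0 ler01.
by rewrite /digit_sum big_ord0 add0r mul1r expr0; apply => //; lra.
Qed.

Lemma digit_sum_le q b n : 0 <= q <= 2^-1 -> digit_sum q b n <= digit_series q b.
Proof.
move=> hq; apply: nondecreasing_cvgn_le (is_cvg_digit_sum _ _ hq) _.
by apply: digit_sum_ndecr; case/andP: hq.
Qed.

Lemma digit_series_le q c b n : 0 <= q <= 2^-1 -> 0 <= c -> q * (1 + c) <= c ->
  digit_series q b <= digit_sum q b n + c * q ^+ n.
Proof.
move=> hq c0 qc; apply: limr_le; first exact: is_cvg_digit_sum.
near=> m; apply: digit_sum_tail => //; first by case/andP: hq.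
by near: m; exact: nbhs_infty_ge.
Unshelve. all: end_near. Qed.

Lemma digit_series_dist q b b' n : 0 <= q <= 2^-1 ->
  (forall k, (k < n)%N -> b k = b' k) ->
  `|digit_series q b - digit_series q b'| <= q ^+ n.
Proof.
move=> hq e.
have := digit_sum_le _ b n hq; have := digit_sum_le _ b' n hq.
have h := digit_series_le _ 1 _ n hq ler01; have := h b; have := h b'.
rewrite (eq_digit_sum _ _ _ _ e) ler_norml => {h} h1 h2; lra.
Qed.

Definition quarter_series b : R := digit_series 4^-1 b.

(** The base 2 expansion is sheared by the base 4 one.  The shear lets the two
    halves of every part overlap in projection, also for slightly tilted
    directions of projection. *)
Definition skew_series b : R := digit_series 2^-1 b - digit_series 4^-1 b.

(** In base 4 with digits 0 and 1 there are no carries: at the first digit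
    where two sequences differ, all later digits together weigh at most half
    as much as this one. *)
Lemma quarter_series_inj : injective quarter_series.
Proof.
suff lt b b' n : (forall k, (k < n)%N -> b k = b' k) -> b n = false ->
    b' n = true -> quarter_series b < quarter_series b'.
  move=> b b' bb'; apply/funext => n0; apply: contrapT => /eqP d0.
  have ex : exists n, b n != b' n by exists n0.
  (* [n] is the first digit where the two sequences differ. *)
  case: (ex_minnP ex) => n d min.
  have e k : (k < n)%N -> b k = b' k.
    by move=> kn; apply/eqP; apply: contraTT kn => /min; rewrite -leqNgt.
  case E : (b n) d; case E' : (b' n) => // _.
    have := lt b' b n (fun k h => esym (e k h)) E' E; rewrite bb'; lra.
  have := lt b b' n e E E'; rewrite bb'; lra.
move=> e E E'; rewrite /quarter_series.
have hq := quarter_bounds.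
have := digit_series_le 4^-1 2^-1 b n.+1 hq; have := digit_sum_le 4^-1 b' n.+1 hq.
rewrite !digit_sumS E E' (eq_digit_sum _ _ _ _ e) /= mul0r mul1r addr0.
have : 0 < 4^-1 ^+ n.+1 :> R by rewrite exprn_gt0//; lra.
move=> ? ? h; have := h _ _; lra.
Qed.

Lemma quarter_series_ge0 b : 0 <= quarter_series b.
Proof.
have := digit_sum_le 4^-1 b 0; rewrite /digit_sum big_ord0; apply.
by apply/andP; split; lra.
Qed.

Lemma quarter_series_le_skew b : quarter_series b <= skew_series b.
Proof.
suff : quarter_series b <= 2^-1 * digit_series 2^-1 b.
  by rewrite /skew_series /quarter_series; lra.
apply: limr_le; first exact: is_cvg_digit_sum quarter_bounds.
apply: nearW => n; apply: le_trans (_ : 2^-1 * digit_sum 2^-1 b n <= _); last first.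
  by rewrite ler_wpM2l ?digit_sum_le ?half_bounds//; lra.
rewrite /digit_sum mulr_sumr ler_sum// => k _.
case: (b k); rewrite ?mul0r ?mulr0// !mul1r !exprS.
have : 4^-1 ^+ k <= 2^-1 ^+ k :> R by rewrite lerXn2r// ?nnegrE; lra.
lra.
Qed.

Lemma skew_series_le1 b : skew_series b <= 1.
Proof.
have h2 := half_bounds.
have := digit_series_le 2^-1 1 b 0 h2; have := quarter_series_ge0 b.
rewrite /skew_series /quarter_series /digit_sum big_ord0 expr0.
move=> h0 h; have := h _ _; lra.
Qed.

(** Digits are chosen greedily: digit [n] is 1 when the curve, at the current
    height, is out of reach of the remaining digits, that is, more than
    [s n.+1] to the right of the current point.  Since the curve drifts by at
    most half of the change in height, its horizontal distance to the current
    point stays between 0 and [s n], hence tends to 0. *)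
Lemma curve_meets_cantor (G : R -> R) :
  (forall y z, 0 <= y <= 1 -> 0 <= z <= 1 -> `|G y - G z| <= 2^-1 * `|y - z|) ->
  0 <= G 0 <= 2^-1 -> exists b, skew_series b = G (quarter_series b).
Proof.
move=> Glip G0.
have h4 := quarter_bounds.
have h2 := half_bounds.
(* This [s] solves [s n = 2 * s n.+1 - 4^-1 ^+ n.+1]: it is the reach that is
   left when each step loses twice the drift [2^-1 * 4^-1 ^+ n.+1]. *)
pose s n : R := 2^-1 ^+ n - 2^-1 * 4^-1 ^+ n.
pose greedy n (p : R * R) := p.1 + s n.+1 < G p.2.
pose st := nat_rect (fun _ => (R * R)%type) (0, 0) (fun n p =>
  (p.1 + (greedy n p)%:R * (2^-1 ^+ n.+1 - 4^-1 ^+ n.+1),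
   p.2 + (greedy n p)%:R * 4^-1 ^+ n.+1)).
pose b n := greedy n (st n).
have stE n : st n = (digit_sum 2^-1 b n - digit_sum 4^-1 b n, digit_sum 4^-1 b n).
  elim: n => [|n IH]; first by rewrite /digit_sum !big_ord0 subrr.
  rewrite !digit_sumS /= -/(b n) IH /=; congr (_, _); ring.
have y01 n : 0 <= (st n).2 <= 1.
  rewrite stE /=; apply/andP; split.
    by apply: sumr_ge0 => k _; rewrite mulr_ge0// exprn_ge0//; lra.
  apply: le_trans (digit_sum_le _ b n h4) _.
  exact: le_trans (quarter_series_le_skew b) (skew_series_le1 b).
have inv n : 0 <= G (st n).2 - (st n).1 <= s n.
  elim: n => [|n]; first by rewrite /s /= subr0 !expr0; lra.
  have := y01 n; have := y01 n.+1; rewrite [st n.+1]/= /greedy.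
  move: (st n) => [x y] /=.
  have q0 : 0 <= 4^-1 ^+ n :> R by rewrite exprn_ge0//; lra.
  rewrite /s !exprS; case: ltP => /= d y1 y0; last by rewrite !mul0r !addr0; lra.
  rewrite !mul1r in y1 *; have := Glip _ _ y1 y0.
  rewrite (addrAC y) subrr add0r (ger0_norm (_ : 0 <= 4^-1 * 4^-1 ^+ n)); last by lra.
  by rewrite ler_norml; lra.
exists b; apply/eqP; rewrite -subr_eq0 -normr_le0.
have le n : `|skew_series b - G (quarter_series b)| <= 4 * 2^-1 ^+ n.
  have := digit_sum_le _ b n h4; have := digit_sum_le _ b n h2.
  have := digit_series_le _ 1 b n h4 ler01; have := digit_series_le _ 1 b n h2 ler01.
  have q1 : 0 <= quarter_series b <= 1.
    by rewrite quarter_series_ge0 (le_trans (quarter_series_le_skew b))// skew_series_le1.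
  have := Glip _ _ q1 (y01 n); have := inv n; rewrite stE /= /s /skew_series.
  rewrite /quarter_series in q1 *.
  have p0 : 0 <= 4^-1 ^+ n :> R by rewrite exprn_ge0//; lra.
  have p1 : 4^-1 ^+ n <= 2^-1 ^+ n :> R by rewrite lerXn2r// ?nnegrE; lra.
  set u := digit_series 2^-1 b; set v := digit_series 4^-1 b.
  set u' := digit_sum 2^-1 b n; set v' := digit_sum 4^-1 b n.
  move=> i l /(_ _) t /(_ _) t' t1 t2.
  have {}t : u <= u' + 1 * 2^-1 ^+ n by apply: t; lra.
  have {}t' : v <= v' + 1 * 4^-1 ^+ n by apply: t'; lra.
  rewrite (ger0_norm (_ : 0 <= v - v')) in l; last lra.
  move: l; rewrite !ler_norml; lra.
have cv : geometric 4 (2^-1 : R) @ \oo --> (0 : R).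
  by apply: cvg_geometric; rewrite ger0_norm; lra.
rewrite -(cvg_lim (@Rhausdorff R) cv).
by apply: limr_ge; [apply/cvg_ex; exists 0|apply: nearW].
Qed.
End digits.

(** * Circles and the pieces *)

Section pieces.
Context {R : realType}.
Implicit Types (a r eta : R) (b : nat -> bool).

Definition piece_point a b : 'rV[R]_2 :=
  \row_j (if j == ord0 then a + skew_series b else quarter_series b).

Lemma piece_point0 a b : piece_point a b ord0 ord0 = a + skew_series b.
Proof. by rewrite mxE. Qed.

Lemma piece_point1 a b : piece_point a b ord0 ord_max = quarter_series b.
Proof. by rewrite mxE. Qed.

Lemma eucl2E (x : 'rV[R]_2) :
  eucl x = Num.sqrt (x ord0 ord0 ^+ 2 + x ord0 ord_max ^+ 2).
Proof.
rewrite /eucl !big_ord_recl big_ord0 addr0.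
by congr (Num.sqrt (_ + x _ _ ^+ 2)); apply: val_inj.
Qed.

Lemma piece_point_inj a : injective (piece_point a).
Proof.
move=> b b' /(congr1 (fun x : 'rV[R]_2 => x ord0 ord_max)).
by rewrite !piece_point1 => /quarter_series_inj.
Qed.

(** The difference of the square roots is the difference of the radicands
    divided by the sum of the roots.  The heights differ by at most 1 from
    that of the centre, so the numerator is at most [2 * |y - z|], and the
    radius is at least 3, so the denominator is at least 4. *)
Lemma circle_lipschitz r c y z : 3 <= r -> 0 <= c <= 1 -> 0 <= y <= 1 ->
  0 <= z <= 1 ->
  `|Num.sqrt (r ^+ 2 - (y - c) ^+ 2) - Num.sqrt (r ^+ 2 - (z - c) ^+ 2)|
    <= 2^-1 * `|y - z|.
Proof.
move=> r3 c01 y01 z01.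
have ge (t : R) : 0 <= t <= 1 -> 2 <= Num.sqrt (r ^+ 2 - (t - c) ^+ 2).
  move=> t01; rewrite -[leLHS]ger0_norm// -sqrtr_sqr ler_wsqrtr//; nra.
have sq (t : R) : 0 <= t <= 1 ->
    Num.sqrt (r ^+ 2 - (t - c) ^+ 2) ^+ 2 = r ^+ 2 - (t - c) ^+ 2.
  by move=> t01; rewrite sqr_sqrtr//; nra.
move: (ge y y01) (ge z z01) (sq y y01) (sq z z01).
set u := Num.sqrt (_ - (y - c) ^+ 2); set v := Num.sqrt (_ - (z - c) ^+ 2).
move=> u2 v2 uE vE.
have e : (u - v) * (u + v) = (z - y) * (y + z - 2 * c).
  by rewrite -subr_sqr uE vE; ring.
have : `|u - v| * `|u + v| = `|y - z| * `|y + z - 2 * c|.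
  by rewrite -normrM e normrM (distrC z).
rewrite (ger0_norm (_ : 0 <= u + v)); last by lra.
have : `|y + z - 2 * c| <= 2 by rewrite ler_norml; lra.
have := normr_ge0 (u - v); have := normr_ge0 (y - z).
have := normr_ge0 (y + z - 2 * c); nra.
Qed.

(** The arc of the circle near the piece at [a'] is the graph of
    [G y = x - (a' - a) + sqrt (r^2 - (y - c)^2)] over the vertical axis, with
    [(x, c)] the offset of the centre in its own piece.  As
    [0 <= c <= x <= eta], the value [G 0] is between [0] and [3 * eta], and
    [3 * eta <= 1/2].  The new offset is [G y <= x - (a' - a) + r <= 3 * eta]. *)
Lemma circle_meets_piece a a' eta r b :
  3 <= a' - a -> eta <= 6^-1 -> skew_series b <= eta ->
  a' - a + eta <= r <= a' - a + 2 * eta ->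
  exists b', skew_series b' <= 3 * eta /\
             eucl (piece_point a b - piece_point a' b') = r.
Proof.
move=> aa' eta6 beta rI; move: beta.
set c : R := quarter_series b; set x : R := skew_series b => beta.
have c0 : 0 <= c by exact: quarter_series_ge0.
have cx : c <= x by exact: quarter_series_le_skew.
pose G y := x - (a' - a) + Num.sqrt (r ^+ 2 - (y - c) ^+ 2).
have Glip y z : 0 <= y <= 1 -> 0 <= z <= 1 -> `|G y - G z| <= 2^-1 * `|y - z|.
  move=> y01 z01; rewrite /G (addrC (_ - _)) (addrC (_ - _)) addrKA.
  by apply: circle_lipschitz => //; lra.
have Gle y : G y <= x - (a' - a) + r.
  rewrite /G lerD2l -[leRHS]ger0_norm; last by lra.
  by rewrite -sqrtr_sqr ler_wsqrtr// gerBl sqr_ge0.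
have G0 : x - (a' - a) + (r - c) <= G 0.
  rewrite /G lerD2l -[leLHS]ger0_norm; last by lra.
  rewrite -sqrtr_sqr ler_wsqrtr//; nra.
have [|b' Eb'] := curve_meets_cantor G Glip; first by have := Gle 0; lra.
exists b'; set y : R := quarter_series b' in Eb'.
have y0 : 0 <= y by exact: quarter_series_ge0.
have yx : y <= skew_series b' by exact: quarter_series_le_skew.
have x1 : (skew_series b' : R) <= 1 by exact: skew_series_le1.
split; first by have := Gle y; rewrite -Eb'; lra.
rewrite eucl2E !mxE /= Eb' -/c -/y -/x /G.
have -> : a + x - (a' + (x - (a' - a) + Num.sqrt (r ^+ 2 - (y - c) ^+ 2))) =
  - Num.sqrt (r ^+ 2 - (y - c) ^+ 2) by ring.
rewrite sqrrN sqr_sqrtr; last by nra.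
rewrite (_ : _ + _ = r ^+ 2); last by ring.
by rewrite sqrtr_sqr ger0_norm//; lra.
Qed.

(** Vertical lines are the curves with constant [G]. *)
Lemma skew_onto (t : R) : 0 <= t <= 2^-1 -> exists b : nat -> bool, skew_series b = t.
Proof.
move=> t01; apply: (curve_meets_cantor (fun=> t)) => // y z _ _.
by rewrite subrr normr0 mulr_ge0//; lra.
Qed.

Lemma eucl_le (x : 'rV[R]_2) : eucl x <= `|x ord0 ord0| + `|x ord0 ord_max|.
Proof.
rewrite eucl2E -[leRHS]ger0_norm ?addr_ge0// -sqrtr_sqr ler_wsqrtr//.
rewrite sqrrD !real_normK ?num_real// lerD2r lerDl.
by rewrite mulrn_wge0// mulr_ge0.
Qed.

Lemma coord0_le_eucl (x : 'rV[R]_2) : `|x ord0 ord0| <= eucl x.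
Proof. by rewrite eucl2E -sqrtr_sqr ler_wsqrtr// lerDl sqr_ge0. Qed.

Lemma skew_series_dist b b' n : (forall k, (k < n)%N -> b k = b' k) ->
  `|skew_series b - skew_series b'| <= 2 * (2^-1 : R) ^+ n.
Proof.
move=> e; have := digit_series_dist _ _ _ _ (@half_bounds R) e.
have := digit_series_dist _ _ _ _ (@quarter_bounds R) e.
have : 4^-1 ^+ n <= 2^-1 ^+ n :> R by rewrite lerXn2r// ?nnegrE; lra.
rewrite /skew_series !ler_norml; lra.
Qed.

Lemma quarter_series_dist b b' n : (forall k, (k < n)%N -> b k = b' k) ->
  `|quarter_series b - quarter_series b'| <= 2 * (2^-1 : R) ^+ n.
Proof.
move=> e; have := digit_series_dist _ _ _ _ (@quarter_bounds R) e.
have : 4^-1 ^+ n <= 2^-1 ^+ n :> R by rewrite lerXn2r// ?nnegrE; lra.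
have : 0 <= 4^-1 ^+ n :> R by rewrite exprn_ge0//; lra.
rewrite /quarter_series !ler_norml; lra.
Qed.

Lemma piece_point_dist a b b' n : (forall k, (k < n)%N -> b k = b' k) ->
  eucl (piece_point a b - piece_point a b') <= 4 * 2^-1 ^+ n.
Proof.
move=> e; apply: le_trans (eucl_le _) _; rewrite !mxE /=.
have := skew_series_dist _ _ _ e; have := quarter_series_dist _ _ _ e.
rewrite (addrC a) addrKA; lra.
Qed.
End pieces.

(** * Finite unions of pieces are Cantor sets *)

Section cantor_pieces.
Context {R : realType}.

Lemma digit_open (n : nat) (e : bool) : open [set b : cantor_space | b n = e].
Proof.
have cn : continuous (fun b : cantor_space => b n : bool).
  exact: (@proj_continuous nat (fun=> bool) n).
exact: open_comp (fun b _ => cn b) (discrete_open [set e]).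
Qed.

Lemma near_same_digits (b : cantor_space) n :
  \forall b' \near b, forall k, (k < n)%N -> b k = b' k.
Proof.
elim: n => [|n IH]; first by apply: filterE => b' k; rewrite ltn0.
have bn : \forall b' \near b, b n = b' n.
  have : nbhs b [set b' : cantor_space | b' n = b n].
    by apply: open_nbhs_nbhs; split => //; exact: digit_open.
  by apply: filterS => b' /= ->.
apply: filterS2 IH bn => b' e en k; rewrite ltnS leq_eqVlt => /orP[/eqP->//|].
exact: e.
Qed.

(** Points whose codes agree on the first [n] digits are close. *)
Lemma piece_point_continuous (a : R) :
  continuous (piece_point a : cantor_space -> 'rV[R]_2).
Proof.
move=> b; apply/cvg_ballP => e e0.
have cv : geometric 2 (2^-1 : R) @ \oo --> (0 : R).
  by apply: cvg_geometric; rewrite ger0_norm; lra.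
have [n _ /(_ n (leqnn _)) small] : \forall n \near \oo, 2 * 2^-1 ^+ n < e.
  by move/cvgrPdist_lt : cv => /(_ _ e0); apply: filterS => n /=;
    rewrite sub0r normrN; apply: le_lt_trans; exact: ler_norm.
have := near_same_digits b n; apply: filterS => b' eb.
split => // i j; rewrite ord1 !mxE /ball /=; apply: le_lt_trans small.
case: eqP => _; last exact: quarter_series_dist.
by rewrite (addrC a) addrKA; exact: skew_series_dist.
Qed.

Definition piece (a : R) : set 'rV[R]_2 := range (piece_point a).

Lemma piece_image_compact (a : R) (B : set cantor_space) :
  closed B -> compact (piece_point a @` B).
Proof.
move=> cB; apply: continuous_compact.
  by apply: continuous_subspaceT => b; exact: piece_point_continuous.
by rewrite -[B]setTI; apply: compact_closedI => //; exact: cantor_space_compact.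
Qed.

Lemma piece_compact (a : R) : compact (piece a).
Proof. exact: piece_image_compact closedT. Qed.

Lemma rV2_compact_closed (A : set 'rV[R]_2) : compact A -> closed A.
Proof. by apply: compact_closed; exact: norm_hausdorff. Qed.

Lemma piece_disjoint (a a' : R) x : 3 <= `|a - a'| -> piece a x -> ~ piece a' x.
Proof.
move=> aa' [b _ <-] [b' _].
move=> /(congr1 (fun x : 'rV[R]_2 => x ord0 ord0)); rewrite !piece_point0.
have := @quarter_series_ge0 R b; have := @quarter_series_le_skew R b.
have := @quarter_series_ge0 R b'; have := @quarter_series_le_skew R b'.
have := @skew_series_le1 R b; have := @skew_series_le1 R b'.
by move: aa'; rewrite ler_normr => /orP[] ? ? ? ? ? ? ? ?; lra.
Qed.

Context {V : finType} (a : V -> R)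
  (far : forall i j, i != j -> 3 <= `|a i - a j|).

Definition pieces : set 'rV[R]_2 := \bigcup_i piece (a i).

Lemma pieces_compact : compact pieces.
Proof.
rewrite (_ : pieces = \bigcup_(i in [set` index_enum V]) piece (a i)).
  by rewrite bigcup_seq; apply: bigsetU_compact => i _; exact: piece_compact.
by apply: eq_bigcupl; split => i _ //=; exact: mem_index_enum.
Qed.

(** The space of codes has no isolated point and each [piece_point a] is
    continuous and injective. *)
Lemma pieces_perfect : perfect_set pieces.
Proof.
have cl : closed pieces by apply: rV2_compact_closed pieces_compact.
split => //; apply/seteqP; split => x.
  move=> lx; apply: cl => U /lx[y [_ Cy Uy]]; by exists y.
move=> [i _ [b _ <-]] U /(piece_point_continuous (a i) b) nU.
have [_ /seteqP[_ /(_ b I)]] := cantor_perfect.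
move=> /(_ _ nU)[b' [b'b _ Ub']]; exists (piece_point (a i) b'); split => //.
  by apply: contra b'b => /eqP/piece_point_inj ->.
by exists i => //; exists b'.
Qed.

(** On [A] the closed sets [K] and [L] are complementary, so [A `&` K] is
    relatively clopen and a connected subset of [A] that meets it lies
    in it. *)
Lemma closed_cover_totally_disconnected (A : set 'rV[R]_2) :
  (forall x y, A x -> A y -> x != y -> exists K L : set 'rV[R]_2,
    [/\ closed K, closed L, A `<=` K `|` L, K `&` L = set0 & K x /\ L y]) ->
  totally_disconnected A.
Proof.
move=> sep x Ax; apply/seteqP; split => [y|_ ->]; last exact: connected_component_refl.
move=> [S [Sx SA conS] Sy]; apply/eqP; rewrite eq_sym; apply: contraPT Sy => xy Sy.
have [K [L [cK cL AKL KL0 [Kx Ly]]]] := sep x y Ax (SA _ Sy) xy.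
have SK : S `&` K = S.
  apply: conS; [by exists x| |by exists K].
  exists (~` L); first exact: closed_openC.
  apply/seteqP; split => z [Sz Kz]; split => //.
    by move=> Lz; have : (K `&` L) z by []; rewrite KL0.
  by case: (AKL z (SA z Sz)).
have : (K `&` L) y by split => //; move: Sy; rewrite -SK => -[].
by rewrite KL0.
Qed.

(** Two points of the same piece differ in some digit.  To fix the value of a
    digit is a clopen condition on the codes, and the images of a clopen set
    of codes and of its complement are disjoint and compact.  Points of
    different pieces are separated by the pieces themselves. *)
Lemma pieces_totally_disconnected : totally_disconnected pieces.
Proof.
apply: closed_cover_totally_disconnected => x y [i _ [b _ <-]] [j _ [b' _ <-]] xy.
have [B [cB cnB Bb Bb']] : exists B : set cantor_space,
    [/\ closed B, closed (~` B), B b & (i = j -> ~ B b')].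
  have [ij|ij] := eqVneq i j; last first.
    exists setT; rewrite setCT; split => //; first exact: closed0.
    by move=> e; rewrite e eqxx in ij.
  have /existsNP[n bn] : ~ forall n, b n = b' n.
    by move=> /funext bb'; rewrite ij bb' eqxx in xy.
  exists [set c : cantor_space | c n = b n]; split => //; last by move=> _ /esym.
    rewrite (_ : mkset _ = ~` [set c : cantor_space | c n = ~~ b n]).
      exact/open_closedC/digit_open.
    by apply/seteqP; split => c /=; case: (c n); case: (b n).
  exact/open_closedC/digit_open.
pose others := \bigcup_(k in [set k | k != i]) piece (a k).
exists (piece_point (a i) @` B), (piece_point (a i) @` (~` B) `|` others); split.
- by apply: rV2_compact_closed; apply: piece_image_compact.
- apply: closedU; first by apply: rV2_compact_closed; apply: piece_image_compact.
  apply: closed_bigcup finite_finset _ => k _; by apply: rV2_compact_closed; apply: piece_compact.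
- move=> _ [k _ [c _ <-]]; have [->|ki] := eqVneq k i; last first.
    by right; right; exists k => //; exists c.
  by have [Bc|Bc] := pselect (B c); [left|right; left]; exists c.
- rewrite -subset0 => _ [[c Bc <-]] [[c' nBc' /piece_point_inj cc']|].
    by apply: nBc'; rewrite cc'.
  move=> [k ki]; apply: (piece_disjoint (a i)); last by exists c.
  by apply: far; rewrite eq_sym.
- split; first by exists b.
  have [ij|ij] := eqVneq j i; last by right; exists j => //; exists b'.
  by left; exists b' => //; [exact: Bb'|rewrite ij].
Qed.

Lemma pieces_cantor : cantor_set pieces.
Proof.
by split; [exact: pieces_compact|exact: pieces_totally_disconnected|
  exact: pieces_perfect].
Qed.
End cantor_pieces.

(** * Hausdorff dimension *)

Section hausdorff_estimates.
Context {R : realType} {n : nat}.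
Implicit Types (A U : set 'rV[R]_n) (s d delta : R).

Lemma eucl_ge0 (x : 'rV[R]_n) : 0 <= eucl x.
Proof. exact: sqrtr_ge0. Qed.

Lemma eucl_le_diam U x y : U x -> U y -> ((eucl (x - y))%:E <= diam U)%E.
Proof. by move=> Ux Uy; apply: ereal_sup_ubound; exists (x, y). Qed.

Lemma diam_ge0 U : U !=set0 -> (0 <= diam U)%E.
Proof.
move=> [x Ux]; apply: le_trans (eucl_le_diam _ _ _ Ux Ux).
by rewrite lee_fin eucl_ge0.
Qed.

Lemma diam_le U d : (forall x y, U x -> U y -> eucl (x - y) <= d) ->
  (diam U <= d%:E)%E.
Proof. by move=> h; apply: ge_ereal_sup => _ [[x y] [/= Ux Uy] <-]; exact: h. Qed.

Lemma diam_pow_ge0 s U : (0 <= diam_pow s U)%E.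
Proof. by rewrite /diam_pow; case: ifP => // _; exact: poweR_ge0. Qed.

Lemma diam_pow_le s d U : 0 <= s -> 0 <= d -> (diam U <= d%:E)%E ->
  (diam_pow s U <= (d `^ s)%:E)%E.
Proof.
move=> s0 d0 Ud; rewrite /diam_pow; case: eqVneq => [_|/set0P U0].
  by rewrite lee_fin powR_ge0.
rewrite -poweR_EFin gt0_ler_poweR// in_itv/= leey andbT ?diam_ge0//.
Qed.

Lemma hausdorff_measure_eq0 s A :
  (forall delta, 0 < delta -> (hausdorff_content_at s delta A <= 0)%E) ->
  hausdorff_measure s A = 0%E.
Proof.
move=> h; apply/eqP; rewrite eq_le; apply/andP; split.
  by apply: ge_ereal_sup => _ [d /= d0 <-]; exact: h.
apply: le_ereal_sup_tmp; exists (hausdorff_content_at s 1 A); first by exists 1 => /=.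
apply: le_ereal_inf_tmp => _ [U _ <-].
by apply: nneseries_ge0 => k _ _; exact: diam_pow_ge0.
Qed.

(** The finite cover is completed to a sequence by empty sets, on which
    [diam_pow] vanishes. *)
Lemma hausdorff_content_finite_cover {J : finType} (F : J -> set 'rV[R]_n)
    s d delta A : 0 <= s -> 0 <= d <= delta -> A `<=` \bigcup_j F j ->
  (forall j x y, F j x -> F j y -> eucl (x - y) <= d) ->
  (hausdorff_content_at s delta A <= (#|J|%:R * d `^ s)%:E)%E.
Proof.
move=> s0 /andP[d0 ddelta] AF Fd.
pose U k := if insub k : option 'I_#|J| is Some i then F (enum_val i) else set0.
have Ud k : (diam (U k) <= d%:E)%E.
  by apply: diam_le; rewrite /U; case: insub => // i x y; exact: Fd.
apply: le_trans (_ : (\sum_(k <oo) diam_pow s (U k) <= _)%E).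
  apply: ereal_inf_lbound; exists U => //=; split; last first.
    by move=> k; apply: le_trans (Ud k) _; rewrite lee_fin.
  move=> x /AF[j _ Fx]; exists (enum_rank j) => //.
  by rewrite /U valK enum_rankK.
apply: lime_le; first by apply: is_cvg_nneseries => k _ _; exact: diam_pow_ge0.
apply: nearW => m.
apply: le_trans (_ : ((minn m #|J|)%:R * d `^ s)%:E <= _)%E; last first.
  by rewrite lee_fin ler_wpM2r ?powR_ge0// ler_nat geq_minr.
elim: m => [|m IH]; first by rewrite big_nil min0n mul0r.
rewrite big_nat_recr//=; have [mJ|Jm] := ltnP m #|J|.
  rewrite (minn_idPl mJ) -natr1 mulrDl mul1r EFinD leeD//.
    by move: IH; rewrite (minn_idPl (ltnW mJ)).
  exact: diam_pow_le.
rewrite (minn_idPr (leqW Jm)) -{1}(minn_idPr Jm) /U insubF ?ltnNge ?Jm//.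
by rewrite /diam_pow eqxx adde0.
Qed.

(** If [s < 1], sets of diameter at most 1 satisfy [diam <= diam `^ s].  So if
    the [s]-dimensional measure of [A] vanished, [A] would have covers with
    arbitrarily small total diameter; since [f] does not increase distances,
    the interval from 0 to [l] would be covered by intervals of total length less than [l],
    against the countable subadditivity of the Lebesgue measure. *)
Lemma hausdorff_dim_ge1 (f : 'rV[R]_n -> R) (l : R) A :
  (forall x y, `|f x - f y| <= eucl (x - y)) -> 0 < l ->
  `[0, l] `<=` f @` A -> (1 <= hausdorff_dim A)%E.
Proof.
move=> flip l0 fA; apply: le_ereal_inf_tmp => _ [s [s0 Hs] <-].
rewrite lee_fin leNgt; apply/negP => s1.
have : (hausdorff_content_at s 1 A < (l / 2)%:E)%E.
  apply: le_lt_trans (_ : _ <= 0)%E _; last by rewrite lte_fin; lra.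
  by rewrite -Hs; apply: ereal_sup_ubound; exists 1 => /=.
move=> /ereal_inf_lt[_ [U [/= AU U1] <-]] sumU.
(* An interval around the image of [U k]; its length is twice the diameter of
   [U k], whence the bound [l / 2] on the cover above. *)
pose J k : set (measurableTypeR R) :=
  if pselect (U k !=set0) is left ex then
    let x := projT1 (cid ex) in let d := fine (diam (U k)) in
    [set` `[f x - d, f x + d]] else set0.
have UfinD k : U k !=set0 -> diam (U k) = (fine (diam (U k)))%:E.
  move=> /diam_ge0 D0; rewrite fineK// ge0_fin_numE//.
  by apply: le_lt_trans (U1 k) _; rewrite ltry.
have mJ k : measurable (J k).
  by rewrite /J; case: pselect => // ex; exact: measurable_itv.
have muJ k : (lebesgue_measure (J k) <= 2%:E * diam_pow s (U k))%E.
  rewrite /J; case: pselect => [ex|_]; last first.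
    by rewrite measure0 mule_ge0// diam_pow_ge0.
  have /set0P/negPf U0 := ex.
  have := diam_ge0 _ ex; have := U1 k; rewrite /diam_pow U0 UfinD//.
  move: (f _) (fine _) => c d; rewrite !lee_fin => d1 d0.
  rewrite poweR_EFin -EFinM; apply: le_trans (_ : (2 * d)%:E <= _)%E; last first.
    rewrite lee_fin ler_wpM2l//; case: (ltgtP 0 d) d0 => // [dp _|<- _].
      by rewrite -[leLHS](powRr1 (ltW dp)) ger_powR ?dp ?(ltW s1).
    exact: powR_ge0.
  rewrite lebesgue_measure_itv /= lte_fin; case: ifP => _; rewrite ?lee_fin; lra.
have mI : measurable ([set` `[0, l]] : set (measurableTypeR R)) by exact: measurable_itv.
have IJ : `[0, l] `<=` \bigcup_k J k.
  move=> t /fA[x Ax <-]; have [k _ Ukx] := AU x Ax.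
  have ex : U k !=set0 by exists x.
  exists k => //; rewrite /J; case: pselect => // {}ex.
  case: cid => y Uy /=; rewrite in_itv/=.
  have := eucl_le_diam _ _ _ Ukx Uy; rewrite UfinD// lee_fin.
  by move=> /(le_trans (flip x y)); rewrite ler_norml; lra.
have : (lebesgue_measure ([set` `[0%R, l]] : set (measurableTypeR R)) <=
    \sum_(k <oo) lebesgue_measure (J k))%E.
  exact: (measure_sigma_subadditive lebesgue_measure mJ mI IJ).
rewrite lebesgue_measure_itv /= lte_fin l0 oppr0 adde0 leNgt => /negP; apply.
apply: (@le_lt_trans _ _ (\sum_(k <oo) 2%:E * diam_pow s (U k))%E).
  by apply: lee_nneseries.
rewrite nneseriesZl; last by move=> k _; exact: diam_pow_ge0.
by rewrite muleC -lte_pdivlMr.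
Qed.
End hausdorff_estimates.

Section dimension_pieces.
Context {R : realType} {V : finType} (a : V -> R).

(** The sequence is geometric of ratio [2 * 2^-1 `^ s = 2 `^ (1 - s)]. *)
Lemma prefix_cover_vanishes (s : R) (m : nat) : 1 < s ->
  (fun n : nat => (m * 2 ^ n)%:R * (4 * 2^-1 ^+ n) `^ s : R) @ \oo --> (0 : R).
Proof.
move=> s1; pose q : R := 2 * 2^-1 `^ s.
have h0 : 0 <= 2^-1 :> R by lra.
have q0 : 0 <= q by rewrite mulr_ge0// powR_ge0.
have q1 : q < 1.
  rewrite /q -(subrKC 1 s) powRD; last by apply/implyP => _; rewrite gt_eqF//; lra.
  rewrite powRr1// mulrA divff// mul1r -[ltRHS](congr1 (fun f => f (s - 1)) (@powR1 R)).
  by apply: gt0_ltr_powR; rewrite ?nnegrE; lra.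
rewrite (_ : (fun _ => _) = geometric (m%:R * 4 `^ s) q); last first.
  apply/funext => n; rewrite /geometric /= natrM natrX powRM// ?exprn_ge0//.
  rewrite -(powR_mulrn n h0) powRAC powR_mulrn ?powR_ge0// /q exprMn; ring.
by apply: cvg_geometric; rewrite ger0_norm.
Qed.

(** For every [s > 1], the covers by the parts with a given prefix of length
    [n] show that the [s]-dimensional measure vanishes. *)
Lemma hausdorff_dim_pieces_le1 : (hausdorff_dim (pieces a) <= 1)%E.
Proof.
apply/lee_addgt0Pr => e e0; rewrite -EFinD; apply: ereal_inf_lbound.
have s0 : 0 <= 1 + e by rewrite addr_ge0// ltW.
exists (1 + e) => //; split => //.
apply: hausdorff_measure_eq0 => delta delta0.
have := prefix_cover_vanishes (1 + e) #|V|; rewrite ltrDl => /(_ e0) cv.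
have cv4 : geometric 4 (2^-1 : R) @ \oo --> (0 : R).
  by apply: cvg_geometric; rewrite ger0_norm; lra.
apply/lee_addgt0Pr => eta eta0; rewrite add0e.
near \oo => n.
have [small fine_enough] : (#|V| * 2 ^ n)%:R * (4 * 2^-1 ^+ n) `^ (1 + e) <= eta /\
    4 * 2^-1 ^+ n <= delta.
  split; near: n.
    by move/cvgrPdist_le : cv => /(_ _ eta0); apply: filterS => n /=;
      rewrite sub0r normrN; apply: le_trans; exact: ler_norm.
  by move/cvgrPdist_le : cv4 => /(_ _ delta0); apply: filterS => n /=;
    rewrite sub0r normrN; apply: le_trans; exact: ler_norm.
pose F (j : V * n.-tuple bool) := piece_point (a j.1) @`
  [set b : nat -> bool | forall k : 'I_n, b k = tnth j.2 k].
apply: le_trans (hausdorff_content_finite_cover F _ (4 * 2^-1 ^+ n) _ _ s0 _ _ _) _.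
- by rewrite mulr_ge0 ?exprn_ge0// ?invr_ge0.
- move=> _ [v _ [b _ <-]]; exists (v, [tuple b k | k < n]) => //.
  by exists b => //= k; rewrite tnth_mktuple.
- move=> j _ _ [b /= bj <-] [b' /= b'j <-]; apply: piece_point_dist => k kn.
  by have := bj (Ordinal kn); rewrite -(b'j (Ordinal kn)).
- by rewrite card_prod card_tuple card_bool lee_fin.
Unshelve. all: end_near. Qed.

Lemma hausdorff_dim_pieces (v : V) : hausdorff_dim (pieces a) = 1%E.
Proof.
apply/eqP; rewrite eq_le hausdorff_dim_pieces_le1/=.
apply: (@hausdorff_dim_ge1 _ _ (fun x => x ord0 ord0 - a v) 2^-1) => //.
- by move=> x y; rewrite opprB addrA subrK; have := coord0_le_eucl (x - y); rewrite !mxE.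
- move=> t /=; rewrite in_itv/= => /skew_onto[b bt].
  exists (piece_point (a v) b); last by rewrite piece_point0 addrAC subrr add0r.
  by exists v => //; exists b.
Qed.
End dimension_pieces.

(** * Rooted trees *)

Section rooted_trees.
Context (T : rtree).

(** The distance to the root: the last edge of a shortest walk from the root
    to [x] comes from a vertex that is closer to the root. *)
Lemma tree_distance : exists dist : T -> nat, forall x, x != Defs.root0 T ->
  exists2 y, adj x y & (dist y < dist x)%N.
Proof.
pose walk n x := `[< exists2 p, size p = n & path (@adj T) (Defs.root0 T) p /\
  last (Defs.root0 T) p = x >].
have ex x : exists n, walk n x.
  have /connectP[p pp xp] := adj_connected (Defs.root0 T) x.
  by exists (size p); apply/asboolP; exists p.
exists (fun x => ex_minn (ex x)) => x xr.
case: ex_minnP => n /asboolP[p <- [pp px]] _.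
case/lastP: p pp px => [_ /= rx|q z]; first by rewrite rx eqxx in xr.
rewrite rcons_path last_rcons size_rcons => /andP[pq az] zx; subst z.
exists (last (Defs.root0 T) q); first by rewrite adj_sym.
by case: ex_minnP => m _; apply; apply/asboolP; exists q.
Qed.

(** The distance to the root need not be injective, so ties are broken by the
    enumeration of the vertices. *)
Lemma tree_parent_rank : exists (parent : T -> T) (rank : T -> nat),
  injective rank /\ forall x, x != Defs.root0 T ->
    adj x (parent x) /\ (rank (parent x) < rank x)%N.
Proof.
have [dist closer] := tree_distance.
have T0 : (0 < #|T|)%N by apply/card_gt0P; exists (Defs.root0 T).
pose rank x := (dist x * #|T| + enum_rank x)%N.
have /choice[parent parentP] : forall x, exists y, x != Defs.root0 T ->
    adj x y /\ (rank y < rank x)%N.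
  move=> x; have [->|xr] := eqVneq x (Defs.root0 T); first by exists x.
  have [y axy yx] := closer x xr; exists y => _; split => //.
  apply: (@leq_trans (dist x * #|T|)); last exact: leq_addr.
  apply: (@leq_trans ((dist y).+1 * #|T|)); last by rewrite leq_mul2r yx orbT.
  by rewrite mulSnr /rank ltn_add2l ltn_ord.
exists parent, rank; split => // x y /(congr1 (modn^~ #|T|)).
by rewrite !modnMDl !modn_small// => /val_inj/enum_rank_inj.
Qed.

(** Distinct vertices other than the root have distinct parent edges, because ranks decrease from
    child to parent.  So there are [#|T|.-1] parent edges, as many as there
    are edges, and no other edge is left. *)
Lemma tree_edges_of_parent (parent : T -> T) (rank : T -> nat) :
  (forall x, x != Defs.root0 T -> adj x (parent x) /\ (rank (parent x) < rank x)%N) ->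
  forall p, p \in edges T -> exists2 x, x != Defs.root0 T &
    p = (x, parent x) \/ p = (parent x, x).
Proof.
move=> parentP.
pose f x := if (enum_rank x < enum_rank (parent x))%N then (x, parent x)
  else (parent x, x).
suff <- : f @: [set~ Defs.root0 T]%SET = edges T.
  move=> p /imsetP[x]; rewrite !inE => xr ->; exists x => //.
  by rewrite /f; case: ifP; [left|right].
apply/eqP; rewrite eqEcard; apply/andP; split.
  apply/fintype.subsetP => _ /imsetP[x + ->]; rewrite !inE => /parentP[ax rx].
  rewrite /f; case: ltngtP => [lt|lt|/val_inj/enum_rank_inj e] /=.
  - by rewrite ax lt.
  - by rewrite adj_sym ax lt.
  - by rewrite -e ltnn in rx.
rewrite card_edges card_in_imset ?cardsC1// => x y.
rewrite !inE => /parentP[_ xr] /parentP[_ yr].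
have swap : x = parent y -> parent x = y -> x = y.
  move=> xy yx; move: xr yr; rewrite yx -xy => lt1 lt2.
  by have := ltn_trans lt1 lt2; rewrite ltnn.
by rewrite /f; do 2 case: ifP => _; case=> // ? ?; apply: swap.
Qed.

Lemma edge_in_edges (j : 'I_(#|T|.-1)) : edge j \in edges T.
Proof. exact: enum_valP. Qed.

Lemma edge_inj : injective (@edge T).
Proof. by move=> i j /enum_val_inj/cast_ord_inj. Qed.

Lemma edge_asym (i j : 'I_(#|T|.-1)) (x y : T) :
  edge i = (x, y) -> edge j <> (y, x).
Proof.
move=> ei ej; have := edge_in_edges i; have := edge_in_edges j.
rewrite ei ej !inE /= => /andP[_ yx] /andP[_ xy].
by have := ltn_trans xy yx; rewrite ltnn.
Qed.

(** All that is needed of a tree: its edges are indexed by their lower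
    endpoints, and [rank] lists the parents before their children. *)
Lemma edge_children : exists (parent : T -> T) (rank : T -> nat)
    (child : 'I_(#|T|.-1) -> T), [/\ injective rank, injective child,
  forall x, x != Defs.root0 T -> (rank (parent x) < rank x)%N &
  forall j, child j != Defs.root0 T /\ (edge j = (child j, parent (child j)) \/
                                   edge j = (parent (child j), child j))].
Proof.
have [parent [rank [rank_inj parentP]]] := tree_parent_rank.
have /choice[child childP] : forall j : 'I_(#|T|.-1), exists x,
    x != Defs.root0 T /\ (edge j = (x, parent x) \/ edge j = (parent x, x)).
  move=> j; have [x xr ex] := tree_edges_of_parent parent rank parentP _ (edge_in_edges j).
  by exists x.
exists parent, rank, child; split => // [i j ij|x /parentP[]//].
apply: edge_inj; have [_ ei] := childP i; have [_ ej] := childP j.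
rewrite -ij in ej; case: ei ej => ei [] ej; rewrite ?ei ?ej //.
  by case: (edge_asym _ _ _ _ ei ej).
by case: (edge_asym _ _ _ _ ej ei).
Qed.
End rooted_trees.

(** * Placing the vertices one after another *)

Section greedy_embedding.
Context {R : realType} {V : finType}
  (root : V) (parent : V -> V) (rank : V -> nat)
  (rank_parent : forall v, v != root -> (rank (parent v) < rank v)%N).

Definition abscissa v : R := 3 * (rank v)%:R.

(** The tolerance on the offset of the point of [v] from the corner of its
    piece, normalized to be at most 1. *)
Definition window v : R := 6 ^+ rank v / 6 ^+ (\max_v rank v).

Definition admissible (r : V -> R) := forall v, v != root ->
  abscissa v - abscissa (parent v) + window (parent v) <= r v <=
  abscissa v - abscissa (parent v) + 2 * window (parent v).

Lemma window_gt0 v : 0 < window v.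
Proof. by rewrite divr_gt0 ?exprn_gt0. Qed.

Lemma window_min v : (6 ^+ (\max_v rank v))^-1 <= window v.
Proof. by rewrite ler_peMl ?invr_ge0 ?exprn_ge0// exprn_ege1//; lra. Qed.

Lemma window_parent v : v != root -> 6 * window (parent v) <= window v.
Proof.
move=> /rank_parent lt; rewrite mulrA -exprS ler_wpM2r ?invr_ge0 ?exprn_ge0//.
by rewrite ler_weXn2l//; lra.
Qed.

Lemma window_le1 v : window v <= 1.
Proof.
rewrite ler_pdivrMr ?exprn_gt0// mul1r ler_weXn2l//; first lra.
exact: leq_bigmax.
Qed.

(** Induction on the rank.  The tolerance at [v] is at most 1 and at least 6
    times that at its parent.  So the latter is at most 1/6, as
    [circle_meets_piece] requires, and the new point, with offset at most 3
    times the tolerance at the parent, is within the tolerance at [v]. *)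
Lemma greedy_embedding (b0 : nat -> bool) : skew_series b0 = 0 :> R ->
  forall r, admissible r -> exists2 c : V -> nat -> bool, c root = b0 &
    forall v, v != root -> eucl (piece_point (abscissa (parent v)) (c (parent v))
                               - piece_point (abscissa v) (c v)) = r v.
Proof.
move=> b0E r rP.
pose good (c : V -> nat -> bool) v b := skew_series b <= window v /\
  (v != root -> eucl (piece_point (abscissa (parent v)) (c (parent v))
                    - piece_point (abscissa v) b) = r v).
suff [c [c0 cP]] : exists c, c root = b0 /\
    forall v, (rank v < (\max_v rank v).+1)%N -> good c v (c v).
  exists c => // v vr; have [_] := cP v (leq_bigmax v); exact.
elim: (\max_v rank v).+1 => [|n [c [c0 cP]]]; first by exists (fun=> b0).
have /choice[next nextP] : forall v, exists b, (v == root -> b = b0) /\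
    (rank v = n -> good c v b).
  move=> v; have [->|vr] := eqVneq v root.
    exists b0; split => // _; split; last by rewrite eqxx.
    by rewrite b0E ltW// window_gt0.
  have [vn|vn] := eqVneq (rank v) n; last by exists b0; split => // /eqP; rewrite (negPf vn).
  have pv := rank_parent _ vr; rewrite vn in pv.
  have [cw _] := cP _ pv; have w6 := window_parent v vr; have w1 := window_le1 v.
  have [||b [bw be]] := circle_meets_piece _ (abscissa v) _ _ _ _ _ cw (rP v vr).
  - rewrite /abscissa -mulrBr ler_peMr// lerBrDr addrC natr1 ler_nat.
    exact: rank_parent.
  - lra.
  by exists b; split => // _; split => //; have := window_gt0 (parent v); lra.
exists (fun v => if (rank v < n)%N then c v else next v); split.
  by case: ifP => // _; apply: (nextP root).1.
move=> v; rewrite ltnS leq_eqVlt => /orP[/eqP vn|vn].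
  rewrite /good vn ltnn; have [nw ne] := (nextP v).2 vn.
  by split => // vr; rewrite -vn rank_parent//; exact: ne.
rewrite /good vn; have [cw ce] := cP v vn.
by split => // vr; rewrite (ltn_trans (rank_parent _ vr) vn); exact: ce.
Qed.
End greedy_embedding.

(** * The Cantor set of a tree *)

Lemma eucl_sym {R : realType} n (x y : 'rV[R]_n) : eucl (x - y) = eucl (y - x).
Proof.
by rewrite /eucl; congr Num.sqrt; apply: eq_bigr => i _; rewrite -opprB !mxE sqrrN.
Qed.

Theorem corollary2p7 (R : realType) (T : rtree) :
  exists C : set 'rV[R]_2,
    [/\ cantor_set C,
        hausdorff_dim C = 1%:E
      & exists2 y : 'rV[R]_2, C y &
          interior (pinned_tree_dist T y C) !=set0].
Proof.
have [parent [rank [child [rank_inj child_inj rank_parent childP]]]] := edge_children T.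
pose a : T -> R := abscissa rank.
have far u v : u != v -> 3 <= `|a u - a v|.
  move=> uv; rewrite -mulrBr normrM ger0_norm// ler_peMr//.
  have : rank u != rank v by apply: contra uv => /eqP/rank_inj ->.
  rewrite neq_ltn => /orP[] lt; [rewrite distrC|]; rewrite -natrB 1?ltnW//.
    by rewrite normr_nat ler1n subn_gt0.
  by rewrite normr_nat ler1n subn_gt0.
have [|b0 b0E] := @skew_onto R 0; first by lra.
exists (pieces a); split.
- exact: pieces_cantor.
- exact: hausdorff_dim_pieces (Defs.root0 T).
exists (piece_point (a (Defs.root0 T)) b0); first by exists (Defs.root0 T) => //; exists b0.
pose w (v : T) : R := window rank v.
(* The centre of the box of admissible radii; its half-widths are all at least
   [e]. *)
exists (\row_j (a (child j) - a (parent (child j)) + 3 / 2 * w (parent (child j)))).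
pose e : R := 2^-1 * (6 ^+ \max_v rank v)^-1.
have e0 : 0 < e by rewrite mulr_gt0 ?invr_gt0 ?exprn_gt0.
apply/nbhs_ballP; exists e => //= t [_ tP].
(* Vertices other than the root are lower endpoints of edges; the other case
   serves to make [r] total. *)
pose r v : R := if [pick j | child j == v] is Some j then t ord0 j else
  a v - a (parent v) + w (parent v).
have rE j : r (child j) = t ord0 j.
  rewrite /r; case: pickP => [i /eqP/child_inj->//|/(_ j)].
  by rewrite eqxx.
have rP : admissible (Defs.root0 T) parent rank r.
  move=> v vr; have w0 := window_gt0 rank (parent v) : 0 < w (parent v).
  rewrite -/(a v) -/(a (parent v)) -/(w (parent v)) /r.
  case: pickP => [j /eqP jv|_]; last by lra.
  have := tP ord0 j; rewrite mxE jv /ball /= ltr_norml.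
  have := window_min rank (parent v) : _ <= w (parent v).
  rewrite -/(w (parent v)) /e; lra.
have [c cr cP] := greedy_embedding _ _ _ rank_parent b0 b0E r rP.
exists (fun v => piece_point (a v) (c v)); last first.
  apply/rowP => j; rewrite mxE -rE.
  have [jr [->|->]] := childP j; last exact: cP.
  by rewrite eucl_sym; exact: cP.
split; last by rewrite cr.
  move=> u v uv; apply/eqP; apply: contraPT uv => /far uv Euv.
  apply: (piece_disjoint _ _ (piece_point (a u) (c u)) uv); first by exists (c u).
  by rewrite Euv; exists (c v).
by move=> v; exists v => //; exists (c v).
Qed.
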